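(* Let $(\tilde L,\tilde\alpha,\tilde\pi,[,],D)$ be a $\mathrm D$-Lie algebra and let $J\subseteq U^{\otimes}(\tilde L)$ be a 2-sided ideal. There is an isomorphism of functors $$\mathrm{Conn}_{\tilde L,J}(-)\cong\mathrm{Hom}_{k\text{-}alg}(U^{\otimes}_J(\tilde L),-)$$ on $\underline{\mathrm{Alg}}(k,A\otimes_kA)$, hence the pair $(U^{\otimes}_J(\tilde L),p^{\otimes}_J)$ represents the functor $\mathrm{Conn}_{\tilde L,J}$. It follows that the pair $(U^{\otimes}_J(\tilde L),p^{\otimes}_J)$ is unique up to unique isomorphism.
   Context: Let $k\to A$ be a unital homomorphism of commutative unital rings. An $A\otimes_kA$-module $M$ is regarded as having commuting left and right actions $am=(a\otimes 1)m$, $ma=(1\otimes a)m$. A 2-cocycle $f\in Z^2(\mathrm{Der}_k(A),A)$ is an alternating $A$-bilinear map with $x(f(y,z))-y(f(x,z))+z(f(x,y))-f([x,y],z)+f([x,z],y)-f([y,z],x)=0$. For such a fixed $f$, $D^1_f(A)=A\oplus\mathrm{Der}_k(A)$, with elements $aI+x$, has actions $c(aI+x)=(ca)I+cx$, $(aI+x)c=(ac+x(c))I+cx$, bracket $[aI+x,bI+y]=(x(b)-y(a)+f(x,y))I+[x,y]$, and projection $\pi(aI+x)=x$. $\mathrm{Der}_k(A)$ carries the trivial right $A$-module structure (right action equal to left action). A $\mathrm D$-Lie algebra is a 5-tuple $(\tilde L,\tilde\alpha,\tilde\pi,[,],D)$ where $\tilde L$ is an $A\otimes_kA$-module and a $k$-Lie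 algebra, $\tilde\alpha:\tilde L\to D^1_f(A)$ and $\tilde\pi:\tilde L\to\mathrm{Der}_k(A)$ are maps of $A\otimes_kA$-modules and $k$-Lie algebras with $\pi\circ\tilde\alpha=\tilde\pi$, $D\in\tilde L$ is central for the Lie bracket, $\tilde\pi(D)=0$, and for all $u,v\in\tilde L$, $c\in A$: $uc=cu+\tilde\pi(u)(c)D$ and $[u,cv]=c[u,v]+\tilde\pi(u)(c)v$. $U^{\otimes}(\tilde L)=T^*_k(\tilde L)/J_1$, where $T^*_k(\tilde L)$ is the tensor algebra over $k$ and $J_1$ is the 2-sided ideal generated by $D-1$, $au-(aD)\otimes u$, $vb-v\otimes(bD)$ ($a,b\in A$, $u,v\in\tilde L$). $U^{\otimes}_J(\tilde L)=U^{\otimes}(\tilde L)/J$, and $p^{\otimes}_J:\tilde L\to U^{\otimes}_J(\tilde L)$ is the canonical map. $U^{\otimes}_J(\tilde L)$ is an $A\otimes_kA$-module by $aw=p^{\otimes}_J(aD)w$, $wa=wp^{\otimes}_J(aD)$. $\underline{\mathrm{Alg}}(k,A\otimes_kA)$ is the category of associative unital $k$-algebras $R$ with $k$ in the center of $R$, equipped with a structure of left $A\otimes_kA$-module; morphisms are unital $k$-algebra maps that are $A\otimes_kA$-linear. For a $k$-linear $\rho:\tilde L\to R$ let $T(\rho):T^*_k(\tilde L)\to R$ be the induced $k$-algebra map, and let $J_T\subseteq T^*_k(\tilde L)$ be the inverse image of $J$. $\mathrm{Conn}_{\tilde L,J}(R)$ is the set of $A\otimes_kA$-linear maps $\rho:\tilde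 L\to R$ with $\rho(D)=1_R$ and $T(\rho)(J_T)=0$.
   Formalization: Objects R of Alg(k, A⊗_kA) are required to have a module structure compatible with the product: a(rs)=(ar)s, (rs)a=r(sa), with k acting through R's algebra structure; Hom is taken in this category (A⊗_kA-linear k-algebra maps). Without this the claim is false. *)

(* Defs.v *)
From HB Require Import structures.
From mathcomp Require Import all_boot all_algebra ring boolp.

Set Implicit Arguments.
Unset Strict Implicit.
Unset Printing Implicit Defensive.

Import GRing.Theory.
Local Open Scope ring_scope.

(* MathComp's [algType] excludes the zero ring, but a quotient by an arbitrary
   two-sided ideal may be zero; hence the following version of an associative
   unital k-algebra, possibly zero, given by a unital ring morphism from k to
   the center. *)
HB.mixin Record PzRing_isPzAlgebra (k : comPzRingType) R
    of GRing.PzRing R := {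
  ink : k -> R;
  inkD : {morph ink : c d / c + d};
  inkM : {morph ink : c d / c * d};
  ink1 : ink 1 = 1;
  inkC : forall c (x : R), ink c * x = x * ink c
}.
#[short(type="pzAlgType")]
HB.structure Definition PzAlgebra (k : comPzRingType) :=
  {R of GRing.PzRing R & PzRing_isPzAlgebra k R}.

#[short(type="comPzAlgType")]
HB.structure Definition ComPzAlgebra (k : comPzRingType) :=
  {R of GRing.ComPzRing R & PzAlgebra k R}.

(* An (A (x)_k A)-module, presented by its two commuting A-actions
   [lact a m] = (a (x) 1) m and [ract m a] = (1 (x) a) m, which restrict to the
   same action of k. *)
HB.mixin Record Zmodule_isBimod (k : comPzRingType) (A : comPzAlgType k) M
    of GRing.Zmodule M := {
  lact : A -> M -> M;
  ract : M -> A -> M;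
  lact1 : forall m, lact 1 m = m;
  lactA : forall a b m, lact a (lact b m) = lact (a * b) m;
  lactDl : forall a b m, lact (a + b) m = lact a m + lact b m;
  lactDr : forall a m n, lact a (m + n) = lact a m + lact a n;
  ract1 : forall m, ract m 1 = m;
  ractA : forall a b m, ract (ract m a) b = ract m (a * b);
  ractDl : forall a m n, ract (m + n) a = ract m a + ract n a;
  ractDr : forall a b m, ract m (a + b) = ract m a + ract m b;
  lractC : forall a b m, ract (lact a m) b = lact a (ract m b);
  lractk : forall (c : k) m, ract m (ink c) = lact (ink c) m
}.
#[short(type="bimodType")]
HB.structure Definition Bimod (k : comPzRingType) (A : comPzAlgType k) :=
  {M of GRing.Zmodule M & Zmodule_isBimod k A M}.

Definition kscale (k : comPzRingType) (A : comPzAlgType k) (M : bimodType A)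
  (c : k) (m : M) : M := lact (ink c) m.

Definition is_bimod_hom (k : comPzRingType) (A : comPzAlgType k)
    (M N : bimodType A) (h : M -> N) : Prop :=
  [/\ forall m n, h (m + n) = h m + h n,
      forall a m, h (lact a m) = lact a (h m) &
      forall m a, h (ract m a) = ract (h m) a].

HB.mixin Record Bimod_isLie (k : comPzRingType) (A : comPzAlgType k) L
    of Bimod k A L := {
  lie : L -> L -> L;
  lieDl : forall u v w : L, lie (u + v) w = lie u w + lie v w;
  lieDr : forall u v w : L, lie u (v + w) = lie u v + lie u w;
  lieZl : forall (c : k) (u v : L), lie (kscale c u) v = kscale c (lie u v);
  lieZr : forall (c : k) (u v : L), lie u (kscale c v) = kscale c (lie u v);
  liexx : forall u : L, lie u u = 0;
  lie_jacobi : forall u v w : L,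
    lie u (lie v w) + lie v (lie w u) + lie w (lie u v) = 0
}.
(* An (A (x)_k A)-module with a k-Lie algebra structure on its underlying
   k-module; the bracket need not be compatible with the A-actions. *)
#[short(type="bimodLieType")]
HB.structure Definition BimodLie (k : comPzRingType) (A : comPzAlgType k) :=
  {L of Bimod k A L & Bimod_isLie k A L}.

Definition is_lie_hom (k : comPzRingType) (A : comPzAlgType k)
    (L L' : bimodLieType A) (h : L -> L') : Prop :=
  [/\ forall u v, h (u + v) = h u + h v,
      forall (c : k) u, h (kscale c u) = kscale c (h u) &
      forall u v, h (lie u v) = lie (h u) (h v)].

Section Derivations.
Variables (k : comPzRingType) (A : comPzAlgType k).

Record der := Der {
  der_fun :> A -> A;
  derD : forall a b, der_fun (a + b) = der_fun a + der_fun b;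
  derZ : forall (c : k) a, der_fun (ink c * a) = ink c * der_fun a;
  derM : forall a b, der_fun (a * b) = a * der_fun b + der_fun a * b
}.

Lemma der_eq (x y : der) : der_fun x =1 der_fun y -> x = y.
Proof.
case: x y => [x xD xZ xM] [y yD yZ yM] /= /funext xy.
by case: _ / xy in yD yZ yM *; congr Der; exact: Prop_irrelevance.
Qed.

Lemma der0 (x : der) : x 0 = 0.
Proof. by apply: (addrI (x 0)); rewrite -derD !addr0. Qed.

Lemma derN (x : der) a : x (- a) = - x a.
Proof. by apply: (addrI (x a)); rewrite -derD !subrr der0. Qed.

Lemma der1 (x : der) : x 1 = 0.
Proof.
have := derM x 1 1; rewrite !mul1r mulr1 => e.
by apply: (addrI (x 1)); rewrite addr0 -e.
Qed.

Lemma derk (x : der) (c : k) : x (ink c) = 0.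
Proof. by rewrite -[ink c]mulr1 derZ der1 mulr0. Qed.

HB.instance Definition _ := gen_eqMixin der.
HB.instance Definition _ := gen_choiceMixin der.

Definition der_zero : der.
Proof. by exists (fun _ => 0) => *; ring. Defined.

Definition der_add (x y : der) : der.
Proof.
by exists (fun a => x a + y a) => *; rewrite ?derD ?derZ ?derM; ring.
Defined.

Definition der_opp (x : der) : der.
Proof. by exists (fun a => - x a) => *; rewrite ?derD ?derZ ?derM; ring. Defined.

Definition der_act (e : A) (x : der) : der.
Proof. by exists (fun a => e * x a) => *; rewrite ?derD ?derZ ?derM; ring. Defined.

Definition der_lie (x y : der) : der.
Proof.
exists (fun a => x (y a) - y (x a)) => *;
  by rewrite ?derD ?derZ ?derM ?derD ?derZ ?derM; ring.
Defined.

Fact der_addA : associative der_add.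
Proof. by move=> x y z; apply: der_eq => a /=; ring. Qed.
Fact der_addC : commutative der_add.
Proof. by move=> x y; apply: der_eq => a /=; ring. Qed.
Fact der_add0 : left_id der_zero der_add.
Proof. by move=> x; apply: der_eq => a /=; ring. Qed.
Fact der_addN : left_inverse der_zero der_opp der_add.
Proof. by move=> x; apply: der_eq => a /=; ring. Qed.
HB.instance Definition _ :=
  GRing.isZmodule.Build der der_addA der_addC der_add0 der_addN.

Lemma der_addE (x y : der) a : (x + y) a = x a + y a. Proof. by []. Qed.

Fact der_act1 x : der_act 1 x = x.
Proof. by apply: der_eq => e /=; ring. Qed.
Fact der_actA a b x : der_act a (der_act b x) = der_act (a * b) x.
Proof. by apply: der_eq => e /=; ring. Qed.
Fact der_actAr a b x : der_act b (der_act a x) = der_act (a * b) x.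
Proof. by apply: der_eq => e /=; ring. Qed.
Fact der_actDl a b x : der_act (a + b) x = der_act a x + der_act b x.
Proof. by apply: der_eq => e; rewrite der_addE /=; ring. Qed.
Fact der_actDr a x y : der_act a (x + y) = der_act a x + der_act a y.
Proof. by apply: der_eq => e /=; rewrite ?der_addE /=; ring. Qed.
Fact der_actC a b x : der_act b (der_act a x) = der_act a (der_act b x).
Proof. by apply: der_eq => e /=; ring. Qed.

(* The right A-action is the trivial one: it equals the left action. *)
HB.instance Definition _ := Zmodule_isBimod.Build k A der
  (ract := fun x a => der_act a x)
  der_act1 der_actA der_actDl der_actDr
  der_act1 der_actAr der_actDr der_actDl der_actC (fun _ _ => erefl).

Lemma der_lactE a (x : der) b : (lact a x : der) b = a * x b. Proof. by []. Qed.

Fact der_lieDl (x y z : der) : der_lie (x + y) z = der_lie x z + der_lie y z.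
Proof.
by apply: der_eq => a; rewrite ?der_addE /= ?der_addE ?derD; ring.
Qed.
Fact der_lieDr (x y z : der) : der_lie x (y + z) = der_lie x y + der_lie x z.
Proof. by apply: der_eq => a; rewrite ?der_addE /= ?der_addE ?derD; ring. Qed.
Fact der_lieZl (c : k) (x y : der) :
  der_lie (kscale c x) y = kscale c (der_lie x y).
Proof. by apply: der_eq => a /=; rewrite derZ; ring. Qed.
Fact der_lieZr (c : k) (x y : der) :
  der_lie x (kscale c y) = kscale c (der_lie x y).
Proof. by apply: der_eq => a /=; rewrite derZ; ring. Qed.
Fact der_liexx x : der_lie x x = 0.
Proof. by apply: der_eq => a /=; rewrite subrr. Qed.
Fact der_lie_jacobi (x y z : der) :
  der_lie x (der_lie y z) + der_lie y (der_lie z x) + der_lie z (der_lie x y)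
    = 0.
Proof.
by apply: der_eq => a; rewrite !der_addE /= !(derD, derN); ring.
Qed.
HB.instance Definition _ := Bimod_isLie.Build k A der
  der_lieDl der_lieDr der_lieZl der_lieZr der_liexx der_lie_jacobi.

Lemma der_lieE (x y : der) a : (lie x y : der) a = x (y a) - y (x a).
Proof. by []. Qed.

Lemma der_lieC (x y : der) : lie x y = - lie y x.
Proof. by apply: der_eq => a /=; ring. Qed.

Record cocycle2 := Cocycle2 {
  coc :> der -> der -> A;
  cocDl : forall x y z, coc (x + y) z = coc x z + coc y z;
  cocDr : forall x y z, coc x (y + z) = coc x y + coc x z;
  cocZl : forall a x y, coc (lact a x) y = a * coc x y;
  cocZr : forall a x y, coc x (lact a y) = a * coc x y;
  cocxx : forall x, coc x x = 0;
  coc_closed : forall x y z : der,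
    x (coc y z) - y (coc x z) + z (coc x y)
      - coc (lie x y) z + coc (lie x z) y - coc (lie y z) x = 0
}.

Lemma cocC (f : cocycle2) x y : f x y = - f y x.
Proof.
have := cocxx f (x + y); rewrite cocDl !cocDr !cocxx add0r addr0 => /eqP.
by rewrite addr_eq0 => /eqP.
Qed.

Lemma cocNl (f : cocycle2) x y : f (- x) y = - f x y.
Proof.
have f0 z : f 0 z = 0 by apply: (addrI (f 0 z)); rewrite -cocDl !addr0.
by apply: (addrI (f x y)); rewrite -cocDl !subrr f0.
Qed.

(* D^1_f(A) = A (+) Der_k(A): the pair (a, x) stands for aI + x. *)
Definition d1 (f : cocycle2) : Type := (A * der)%type.

Section D1.
Variable f : cocycle2.

HB.instance Definition _ := GRing.Zmodule.copy (d1 f) (A * der)%type.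

Definition d1_lact (c : A) (u : d1 f) : d1 f := (c * u.1, lact c u.2).
Definition d1_ract (u : d1 f) (c : A) : d1 f :=
  (u.1 * c + u.2 c, lact c u.2).
Definition d1_lie (u v : d1 f) : d1 f :=
  (u.2 v.1 - v.2 u.1 + f u.2 v.2, lie u.2 v.2).

Lemma d1_addE (u v : d1 f) : u + v = (u.1 + v.1, u.2 + v.2) :> d1 f.
Proof. by []. Qed.

Fact d1_lact1 u : d1_lact 1 u = u.
Proof. by case: u => a x; rewrite /d1_lact /= mul1r lact1. Qed.
Fact d1_lactA a b u : d1_lact a (d1_lact b u) = d1_lact (a * b) u.
Proof. by rewrite /d1_lact /= lactA mulrA. Qed.
Fact d1_lactDl a b u : d1_lact (a + b) u = d1_lact a u + d1_lact b u.
Proof. by rewrite d1_addE /d1_lact /= lactDl mulrDl. Qed.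
Fact d1_lactDr a u v : d1_lact a (u + v) = d1_lact a u + d1_lact a v.
Proof. by rewrite !d1_addE /d1_lact /= lactDr mulrDr. Qed.
Fact d1_ract1 u : d1_ract u 1 = u.
Proof. by case: u => a x; rewrite /d1_ract /= mulr1 der1 addr0 lact1. Qed.
Fact d1_ractA a b u : d1_ract (d1_ract u a) b = d1_ract u (a * b).
Proof.
case: u => e x; rewrite /d1_ract /= lactA derM; congr pair; last by rewrite mulrC.
by ring.
Qed.
Fact d1_ractDl a u v : d1_ract (u + v) a = d1_ract u a + d1_ract v a.
Proof.
by rewrite !d1_addE /d1_ract /= lactDr ?der_addE; congr pair; ring.
Qed.
Fact d1_ractDr a b u : d1_ract u (a + b) = d1_ract u a + d1_ract u b.
Proof.
by rewrite !d1_addE /d1_ract /= lactDl derD; congr pair; ring.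
Qed.
Fact d1_lractC a b u : d1_ract (d1_lact a u) b = d1_lact a (d1_ract u b).
Proof.
rewrite /d1_ract /d1_lact /= !lactA; congr pair; last by rewrite mulrC.
by ring.
Qed.
Fact d1_lractk (c : k) u : d1_ract u (ink c) = d1_lact (ink c) u.
Proof. by rewrite /d1_ract /d1_lact derk addr0 mulrC. Qed.
HB.instance Definition _ := Zmodule_isBimod.Build k A (d1 f)
  d1_lact1 d1_lactA d1_lactDl d1_lactDr d1_ract1 d1_ractA d1_ractDl d1_ractDr
  d1_lractC d1_lractk.

Fact d1_lieDl u v w : d1_lie (u + v) w = d1_lie u w + d1_lie v w.
Proof.
rewrite !d1_addE /d1_lie /= lieDl cocDl derD; congr pair.
by rewrite ?der_addE /=; ring.
Qed.
Fact d1_lieDr u v w : d1_lie u (v + w) = d1_lie u v + d1_lie u w.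
Proof.
rewrite !d1_addE /d1_lie /= lieDr cocDr derD; congr pair.
by rewrite ?der_addE /=; ring.
Qed.
Fact d1_lieZl (c : k) (u v : d1 f) :
  d1_lie (kscale c u) v = kscale c (d1_lie u v).
Proof.
rewrite /d1_lie /= lieZl; congr pair.
by rewrite cocZl derZ /=; ring.
Qed.
Fact d1_lieZr (c : k) (u v : d1 f) :
  d1_lie u (kscale c v) = kscale c (d1_lie u v).
Proof.
rewrite /d1_lie /= lieZr; congr pair.
by rewrite cocZr derZ /=; ring.
Qed.
Fact d1_liexx u : d1_lie u u = 0.
Proof. by rewrite /d1_lie liexx cocxx subrr addr0. Qed.
Fact d1_lie_jacobi u v w :
  d1_lie u (d1_lie v w) + d1_lie v (d1_lie w u) + d1_lie w (d1_lie u v) = 0.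
Proof.
case: u v w => [a x] [b y] [c z].
rewrite !d1_addE /d1_lie /= lie_jacobi; congr pair.
rewrite ?der_lieE !(derD, derN) [f x (lie y z)]cocC [f y (lie z x)]cocC.
rewrite [f z (lie x y)]cocC -[X in _ = X](coc_closed f x y z).
by rewrite [lie x z]der_lieC cocNl [f z x]cocC derN; ring.
Qed.
HB.instance Definition _ := Bimod_isLie.Build k A (d1 f)
  d1_lieDl d1_lieDr d1_lieZl d1_lieZr d1_liexx d1_lie_jacobi.

Definition d1_pi (u : d1 f) : der := u.2.

End D1.
End Derivations.

Record dLieAlg (k : comPzRingType) (A : comPzAlgType k) (f : cocycle2 A) :=
    DLieAlg {
  dl_car :> bimodLieType A;
  dl_alpha : dl_car -> d1 f;
  dl_pi : dl_car -> der A;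
  dl_D : dl_car;
  dl_alpha_bimod : is_bimod_hom dl_alpha;
  dl_alpha_lie : is_lie_hom dl_alpha;
  dl_pi_bimod : is_bimod_hom dl_pi;
  dl_pi_lie : is_lie_hom dl_pi;
  dl_pi_alpha : forall u, d1_pi (dl_alpha u) = dl_pi u;
  dl_D_central : forall u, lie dl_D u = 0;
  dl_pi_D : dl_pi dl_D = 0;
  dl_ract : forall u c, ract u c = lact c u + lact (dl_pi u c) dl_D;
  dl_lie_lact : forall u v c,
    lie u (lact c v) = lact c (lie u v) + lact (dl_pi u c) v
}.
Arguments dl_D {k A f} _.
Arguments dl_pi {k A f} _ _.

Definition is_alg_hom (k : comPzRingType) (R S : pzAlgType k) (h : R -> S) :
    Prop :=
  [/\ forall x y, h (x + y) = h x + h y,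
      forall x y, h (x * y) = h x * h y,
      h 1 = 1 &
      forall c : k, h (ink c) = ink c].

Section Classes.
Variables (T : Type) (E : T -> T -> Prop).

Record classes := Classes {
  cl_set : T -> Prop;
  cl_ex : exists x, cl_set = E x
}.

Definition cl x : classes := Classes (ex_intro _ x erefl).
Definition rep (q : classes) : T := projT1 (cid (cl_ex q)).

HB.instance Definition _ := gen_eqMixin classes.
HB.instance Definition _ := gen_choiceMixin classes.

Lemma classes_eq (p q : classes) : cl_set p = cl_set q -> p = q.
Proof.
case: p q => [S exS] [S' exS'] /= e; case: _ / e in exS' *.
by congr Classes; exact: Prop_irrelevance.
Qed.

Lemma repK : cancel rep cl.
Proof. by move=> q; apply: classes_eq; rewrite /rep; case: cid => x /= ->. Qed.

Hypothesis Erefl : forall x, E x x.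
Hypothesis Esym : forall x y, E x y -> E y x.
Hypothesis Etrans : forall x y z, E x y -> E y z -> E x z.

Lemma cl_eq x y : E x y -> cl x = cl y.
Proof.
move=> xy; apply: classes_eq; apply/funext => z; apply/propext.
by split=> [|yz]; [apply: Etrans; exact: Esym|exact: Etrans yz].
Qed.

Lemma cl_inj x y : cl x = cl y -> E x y.
Proof. by move=> /(congr1 cl_set) /= ->. Qed.

Lemma rep_cl x : E (rep (cl x)) x.
Proof. by apply: cl_inj; rewrite repK. Qed.

End Classes.

Section Ideals.
Variable R : pzRingType.

Record ideal2 := Ideal2 {
  ideal_mem :> R -> Prop;
  ideal0 : ideal_mem 0;
  idealD : forall x y, ideal_mem x -> ideal_mem y -> ideal_mem (x + y);
  idealMl : forall r x, ideal_mem x -> ideal_mem (r * x);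
  idealMr : forall r x, ideal_mem x -> ideal_mem (x * r)
}.

Lemma idealN (I : ideal2) x : I x -> I (- x).
Proof. by move=> Ix; rewrite -mulN1r; exact: idealMl. Qed.

Definition ideal_gen (S : R -> Prop) : ideal2.
Proof.
exists (fun x => forall I : ideal2, (forall s, S s -> I s) -> I x).
- by move=> I _; exact: ideal0.
- by move=> x y Sx Sy I SI; apply: idealD; [exact: Sx|exact: Sy].
- by move=> r x Sx I SI; apply: idealMl; exact: Sx.
- by move=> r x Sx I SI; apply: idealMr; exact: Sx.
Defined.

Lemma ideal_gen_mem (S : R -> Prop) s : S s -> ideal_gen S s.
Proof. by move=> Ss I; exact. Qed.

End Ideals.

Section Quotients.
Variables (k : comPzRingType) (R : pzAlgType k) (I : ideal2 R).

Definition quot_eq (x y : R) : Prop := I (x - y).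
Definition quot : Type := classes quot_eq.
Definition quot_pi : R -> quot := @cl R quot_eq.

HB.instance Definition _ := Choice.on quot.

Lemma quot_refl x : quot_eq x x.
Proof. by rewrite /quot_eq subrr; exact: ideal0. Qed.
Lemma quot_sym x y : quot_eq x y -> quot_eq y x.
Proof. by move=> /idealN; rewrite opprB. Qed.
Lemma quot_trans x y z : quot_eq x y -> quot_eq y z -> quot_eq x z.
Proof.
by move=> xy yz; have := idealD xy yz; rewrite addrA subrK.
Qed.

Lemma quot_pi_eq x y : I (x - y) -> quot_pi x = quot_pi y.
Proof. exact: cl_eq quot_sym quot_trans _ _. Qed.
Lemma quot_pi_inj x y : quot_pi x = quot_pi y -> I (x - y).
Proof. exact: cl_inj quot_refl _ _. Qed.
Lemma quot_rep x : I (rep (quot_pi x) - x).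
Proof. exact: rep_cl quot_refl x. Qed.
Lemma quotW (P : quot -> Prop) : (forall x, P (quot_pi x)) -> forall q, P q.
Proof. by move=> Ppi q; rewrite -(repK q); exact: Ppi. Qed.

Definition quot_add (p q : quot) := quot_pi (rep p + rep q).
Definition quot_opp (p : quot) := quot_pi (- rep p).
Definition quot_mul (p q : quot) := quot_pi (rep p * rep q).

Lemma quot_addE x y : quot_add (quot_pi x) (quot_pi y) = quot_pi (x + y).
Proof.
by apply: quot_pi_eq; rewrite opprD addrACA; apply: idealD; exact: quot_rep.
Qed.
Lemma quot_oppE x : quot_opp (quot_pi x) = quot_pi (- x).
Proof. by apply: quot_pi_eq; rewrite -opprD; apply: idealN; exact: quot_rep. Qed.
Lemma quot_mulE x y : quot_mul (quot_pi x) (quot_pi y) = quot_pi (x * y).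
Proof.
apply: quot_pi_eq; rewrite -[_ * _](subrK (rep (quot_pi x) * y)) -mulrBr.
rewrite -addrA -mulrBl; apply: idealD; first exact/idealMl/quot_rep.
exact/idealMr/quot_rep.
Qed.

Fact quot_addA : associative quot_add.
Proof. by do 3!elim/quotW=> ?; rewrite !quot_addE addrA. Qed.
Fact quot_addC : commutative quot_add.
Proof. by do 2!elim/quotW=> ?; rewrite !quot_addE addrC. Qed.
Fact quot_add0 : left_id (quot_pi 0) quot_add.
Proof. by elim/quotW=> ?; rewrite quot_addE add0r. Qed.
Fact quot_addN : left_inverse (quot_pi 0) quot_opp quot_add.
Proof. by elim/quotW=> ?; rewrite quot_oppE quot_addE addNr. Qed.
Fact quot_mulA : associative quot_mul.
Proof. by do 3!elim/quotW=> ?; rewrite !quot_mulE mulrA. Qed.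
Fact quot_mul1 : left_id (quot_pi 1) quot_mul.
Proof. by elim/quotW=> ?; rewrite quot_mulE mul1r. Qed.
Fact quot_mulr1 : right_id (quot_pi 1) quot_mul.
Proof. by elim/quotW=> ?; rewrite quot_mulE mulr1. Qed.
Fact quot_mulDl : left_distributive quot_mul quot_add.
Proof.
by do 3!elim/quotW=> ?; rewrite !(quot_mulE, quot_addE) mulrDl.
Qed.
Fact quot_mulDr : right_distributive quot_mul quot_add.
Proof.
by do 3!elim/quotW=> ?; rewrite !(quot_mulE, quot_addE) mulrDr.
Qed.
HB.instance Definition _ := GRing.isPzRing.Build quot
  quot_addA quot_addC quot_add0 quot_addN
  quot_mulA quot_mul1 quot_mulr1 quot_mulDl quot_mulDr.

Lemma quot_piD x y : quot_pi (x + y) = quot_pi x + quot_pi y.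
Proof. by rewrite -quot_addE. Qed.
Lemma quot_piM x y : quot_pi (x * y) = quot_pi x * quot_pi y.
Proof. by rewrite -quot_mulE. Qed.

Definition quot_ink (c : k) : quot := quot_pi (ink c).
Fact quot_inkD : {morph quot_ink : c d / c + d}.
Proof. by move=> c d; rewrite /quot_ink inkD quot_piD. Qed.
Fact quot_inkM : {morph quot_ink : c d / c * d}.
Proof. by move=> c d; rewrite /quot_ink inkM quot_piM. Qed.
Fact quot_ink1 : quot_ink 1 = 1.
Proof. by rewrite /quot_ink ink1. Qed.
Fact quot_inkC c (x : quot) : quot_ink c * x = x * quot_ink c.
Proof. by elim/quotW: x => x; rewrite -!quot_piM inkC. Qed.
HB.instance Definition _ := PzRing_isPzAlgebra.Build k quot
  quot_inkD quot_inkM quot_ink1 quot_inkC.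

Lemma quot_pi_alg_hom : is_alg_hom quot_pi.
Proof. by split=> // *; rewrite ?quot_piD ?quot_piM. Qed.

End Quotients.

Section TensorAlgebra.
Variables (k : comPzRingType) (A : comPzAlgType k) (M : bimodType A).

(* T*_k(M), the tensor algebra over k of the underlying k-module of M, as the
   free unital k-algebra on the elements of M modulo the k-linearity of the
   generators; [tens_liftP] and [tens_lift_uniq] are its universal property. *)
Inductive tens_expr : Type :=
| TScal of k
| TGen of M
| TAdd of tens_expr & tens_expr
| TMul of tens_expr & tens_expr.

Inductive tens_eq : tens_expr -> tens_expr -> Prop :=
| tens_refl x : tens_eq x x
| tens_sym x y : tens_eq x y -> tens_eq y x
| tens_trans x y z : tens_eq x y -> tens_eq y z -> tens_eq x z
| tens_add x x' y y' :
    tens_eq x x' -> tens_eq y y' -> tens_eq (TAdd x y) (TAdd x' y')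
| tens_mul x x' y y' :
    tens_eq x x' -> tens_eq y y' -> tens_eq (TMul x y) (TMul x' y')
| tens_addA x y z : tens_eq (TAdd x (TAdd y z)) (TAdd (TAdd x y) z)
| tens_addC x y : tens_eq (TAdd x y) (TAdd y x)
| tens_add0 x : tens_eq (TAdd (TScal 0) x) x
| tens_mulA x y z : tens_eq (TMul x (TMul y z)) (TMul (TMul x y) z)
| tens_mul1 x : tens_eq (TMul (TScal 1) x) x
| tens_mul0 x : tens_eq (TMul (TScal 0) x) (TScal 0)
| tens_mulDl x y z : tens_eq (TMul (TAdd x y) z) (TAdd (TMul x z) (TMul y z))
| tens_mulDr x y z : tens_eq (TMul x (TAdd y z)) (TAdd (TMul x y) (TMul x z))
| tens_scalD c d : tens_eq (TScal (c + d)) (TAdd (TScal c) (TScal d))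
| tens_scalM c d : tens_eq (TScal (c * d)) (TMul (TScal c) (TScal d))
| tens_scalC c x : tens_eq (TMul (TScal c) x) (TMul x (TScal c))
| tens_genD m n : tens_eq (TGen (m + n)) (TAdd (TGen m) (TGen n))
| tens_genZ c m : tens_eq (TGen (kscale c m)) (TMul (TScal c) (TGen m)).

Definition tens : Type := classes tens_eq.
Definition tens_pi : tens_expr -> tens := @cl _ tens_eq.

HB.instance Definition _ := Choice.on tens.

Lemma tens_pi_eq x y : tens_eq x y -> tens_pi x = tens_pi y.
Proof. exact: cl_eq tens_sym tens_trans _ _. Qed.
Lemma tens_rep x : tens_eq (rep (tens_pi x)) x.
Proof. exact: rep_cl tens_refl x. Qed.
Lemma tensW (P : tens -> Prop) : (forall x, P (tens_pi x)) -> forall t, P t.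
Proof. by move=> Ppi t; rewrite -(repK t); exact: Ppi. Qed.

Definition tens_addt (s t : tens) := tens_pi (TAdd (rep s) (rep t)).
Definition tens_mult (s t : tens) := tens_pi (TMul (rep s) (rep t)).
Definition tens_oppt (t : tens) := tens_pi (TMul (TScal (-1)) (rep t)).

Lemma tens_addE x y : tens_addt (tens_pi x) (tens_pi y) = tens_pi (TAdd x y).
Proof. by apply: tens_pi_eq; apply: tens_add; exact: tens_rep. Qed.
Lemma tens_mulE x y : tens_mult (tens_pi x) (tens_pi y) = tens_pi (TMul x y).
Proof. by apply: tens_pi_eq; apply: tens_mul; exact: tens_rep. Qed.
Lemma tens_oppE x : tens_oppt (tens_pi x) = tens_pi (TMul (TScal (-1)) x).
Proof.
by apply: tens_pi_eq; apply: tens_mul; [exact: tens_refl|exact: tens_rep].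
Qed.

Fact tens_raddA : associative tens_addt.
Proof.
do 3!elim/tensW=> ?; rewrite !tens_addE; exact/tens_pi_eq/tens_addA.
Qed.
Fact tens_raddC : commutative tens_addt.
Proof.
do 2!elim/tensW=> ?; rewrite !tens_addE; exact/tens_pi_eq/tens_addC.
Qed.
Fact tens_radd0 : left_id (tens_pi (TScal 0)) tens_addt.
Proof. by elim/tensW=> ?; rewrite tens_addE; exact/tens_pi_eq/tens_add0. Qed.
Fact tens_raddN : left_inverse (tens_pi (TScal 0)) tens_oppt tens_addt.
Proof.
elim/tensW=> x; rewrite tens_oppE tens_addE; apply: tens_pi_eq.
apply: tens_trans (tens_mul0 x).
apply: (@tens_trans _ (TAdd (TMul (TScal (-1)) x) (TMul (TScal 1) x))).
  by apply: tens_add; [exact: tens_refl|exact/tens_sym/tens_mul1].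
apply: tens_trans (tens_sym (tens_mulDl _ _ _)) _.
apply: tens_mul; last exact: tens_refl.
by apply: tens_trans (tens_sym (tens_scalD _ _)) _; rewrite addNr; exact: tens_refl.
Qed.
Fact tens_rmulA : associative tens_mult.
Proof.
do 3!elim/tensW=> ?; rewrite !tens_mulE; exact/tens_pi_eq/tens_mulA.
Qed.
Fact tens_rmul1 : left_id (tens_pi (TScal 1)) tens_mult.
Proof. by elim/tensW=> ?; rewrite tens_mulE; exact/tens_pi_eq/tens_mul1. Qed.
Fact tens_rmulr1 : right_id (tens_pi (TScal 1)) tens_mult.
Proof.
elim/tensW=> ?; rewrite tens_mulE; apply: tens_pi_eq.
exact: tens_trans (tens_sym (tens_scalC _ _)) (tens_mul1 _).
Qed.
Fact tens_rmulDl : left_distributive tens_mult tens_addt.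
Proof.
do 3!elim/tensW=> ?; rewrite !(tens_mulE, tens_addE).
exact/tens_pi_eq/tens_mulDl.
Qed.
Fact tens_rmulDr : right_distributive tens_mult tens_addt.
Proof.
do 3!elim/tensW=> ?; rewrite !(tens_mulE, tens_addE).
exact/tens_pi_eq/tens_mulDr.
Qed.
HB.instance Definition _ := GRing.isPzRing.Build tens
  tens_raddA tens_raddC tens_radd0 tens_raddN
  tens_rmulA tens_rmul1 tens_rmulr1 tens_rmulDl tens_rmulDr.

Lemma tens_piD x y : tens_pi (TAdd x y) = tens_pi x + tens_pi y.
Proof. by rewrite -tens_addE. Qed.
Lemma tens_piM x y : tens_pi (TMul x y) = tens_pi x * tens_pi y.
Proof. by rewrite -tens_mulE. Qed.

Definition tens_ink (c : k) : tens := tens_pi (TScal c).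
Fact tens_inkD : {morph tens_ink : c d / c + d}.
Proof. by move=> c d; rewrite -tens_piD; exact/tens_pi_eq/tens_scalD. Qed.
Fact tens_inkM : {morph tens_ink : c d / c * d}.
Proof. by move=> c d; rewrite -tens_piM; exact/tens_pi_eq/tens_scalM. Qed.
Fact tens_inkC c (t : tens) : tens_ink c * t = t * tens_ink c.
Proof.
by elim/tensW: t => x; rewrite -!tens_piM; exact/tens_pi_eq/tens_scalC.
Qed.
HB.instance Definition _ := PzRing_isPzAlgebra.Build k tens
  tens_inkD tens_inkM erefl tens_inkC.

Definition tens_in (m : M) : tens := tens_pi (TGen m).

Lemma tens_inD m n : tens_in (m + n) = tens_in m + tens_in n.
Proof. by rewrite -tens_piD; exact/tens_pi_eq/tens_genD. Qed.
Lemma tens_inZ c m : tens_in (kscale c m) = ink c * tens_in m.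
Proof. by rewrite -tens_piM; exact/tens_pi_eq/tens_genZ. Qed.

Section Lift.
Variables (R : pzAlgType k) (rho : M -> R).

Fixpoint tens_eval (x : tens_expr) : R :=
  match x with
  | TScal c => ink c
  | TGen m => rho m
  | TAdd x y => tens_eval x + tens_eval y
  | TMul x y => tens_eval x * tens_eval y
  end.

(* T(rho); it is the expected algebra morphism as soon as rho is k-linear. *)
Definition tens_lift (t : tens) : R := tens_eval (rep t).

Hypothesis rhoD : forall m n, rho (m + n) = rho m + rho n.
Hypothesis rhoZ : forall (c : k) m, rho (kscale c m) = ink c * rho m.

Lemma ink0 (S : pzAlgType k) : ink 0 = 0 :> S.
Proof. by apply: (addrI (ink 0)); rewrite -inkD !addr0. Qed.

Lemma tens_eval_eq x y : tens_eq x y -> tens_eval x = tens_eval y.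
Proof.
elim=> {x y} //= *; rewrite ?ink0 ?ink1 ?mul0r ?mul1r ?add0r //;
  by [congruence|rewrite addrA|rewrite addrC|rewrite mulrA|rewrite mulrDl
     |rewrite mulrDr|rewrite inkD|rewrite inkM|rewrite inkC
     |rewrite rhoD|rewrite rhoZ].
Qed.

Lemma tens_lift_pi x : tens_lift (tens_pi x) = tens_eval x.
Proof. exact/tens_eval_eq/tens_rep. Qed.

Lemma tens_liftP :
  is_alg_hom tens_lift /\ (forall m, tens_lift (tens_in m) = rho m).
Proof.
split; last by move=> m; rewrite tens_lift_pi.
split.
- by elim/tensW=> x; elim/tensW=> y; rewrite -tens_piD !tens_lift_pi.
- by elim/tensW=> x; elim/tensW=> y; rewrite -tens_piM !tens_lift_pi.
- by rewrite tens_lift_pi /= ink1.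
- by move=> c; rewrite tens_lift_pi.
Qed.

Lemma tens_lift_uniq (h : tens -> R) :
  is_alg_hom h -> (forall m, h (tens_in m) = rho m) -> h =1 tens_lift.
Proof.
case=> hD hM _ hk hin; elim/tensW=> x; rewrite tens_lift_pi.
elim: x => [c|m|x IHx y IHy|x IHx y IHy] /=; first exact: hk.
- exact: hin.
- by rewrite tens_piD hD IHx IHy.
- by rewrite tens_piM hM IHx IHy.
Qed.

End Lift.
End TensorAlgebra.

Section Universal.
Variables (k : comPzRingType) (A : comPzAlgType k) (f : cocycle2 A).
Variable L : dLieAlg f.

Inductive uotimes_rel : tens L -> Prop :=
| uotimes_D : uotimes_rel (tens_in (dl_D L) - 1)
| uotimes_l (a : A) (u : L) :
    uotimes_rel (tens_in (lact a u) - tens_in (lact a (dl_D L)) * tens_in u)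
| uotimes_r (b : A) (v : L) :
    uotimes_rel (tens_in (ract v b) - tens_in v * tens_in (lact b (dl_D L))).

Definition uotimes : pzAlgType k := quot (ideal_gen uotimes_rel).

Variable J : ideal2 uotimes.

Definition uJ : Type := quot J.
HB.instance Definition _ := PzAlgebra.on uJ.

Definition uJ_can (t : tens L) : uJ :=
  quot_pi J (quot_pi (ideal_gen uotimes_rel) t).

(* J_T, the inverse image of J in the tensor algebra. *)
Definition preJ (t : tens L) : Prop :=
  J (quot_pi (ideal_gen uotimes_rel) t).

Definition pJ (u : L) : uJ := uJ_can (tens_in u).

Lemma uJ_can_alg_hom : is_alg_hom uJ_can.
Proof.
by split=> *; rewrite /uJ_can ?(quot_piD, quot_piM).
Qed.

Lemma pJ_D : pJ (dl_D L) = 1.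
Proof.
congr (quot_pi J _); apply: quot_pi_eq; apply: ideal_gen_mem.
exact: uotimes_D.
Qed.
Lemma pJD u v : pJ (u + v) = pJ u + pJ v.
Proof. by rewrite /pJ tens_inD /uJ_can !quot_piD. Qed.
Lemma pJZ (c : k) u : pJ (kscale c u) = ink c * pJ u.
Proof. by rewrite /pJ tens_inZ /uJ_can !quot_piM. Qed.
Lemma pJ_lact a u : pJ (lact a u) = pJ (lact a (dl_D L)) * pJ u.
Proof.
rewrite /pJ /uJ_can -!quot_piM; congr (quot_pi J _).
by apply: quot_pi_eq; apply: ideal_gen_mem; exact: uotimes_l.
Qed.
Lemma pJ_ract u b : pJ (ract u b) = pJ u * pJ (lact b (dl_D L)).
Proof.
rewrite /pJ /uJ_can -!quot_piM; congr (quot_pi J _).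
by apply: quot_pi_eq; apply: ideal_gen_mem; exact: uotimes_r.
Qed.

Definition uJ_lact (a : A) (w : uJ) : uJ := pJ (lact a (dl_D L)) * w.
Definition uJ_ract (w : uJ) (a : A) : uJ := w * pJ (lact a (dl_D L)).

Lemma pJ_act1 : pJ (lact 1 (dl_D L)) = 1.
Proof. by rewrite lact1 pJ_D. Qed.
Lemma pJ_actD a b :
  pJ (lact (a + b) (dl_D L)) = pJ (lact a (dl_D L)) + pJ (lact b (dl_D L)).
Proof. by rewrite lactDl pJD. Qed.
Lemma pJ_actM a b :
  pJ (lact (a * b) (dl_D L)) = pJ (lact a (dl_D L)) * pJ (lact b (dl_D L)).
Proof. by rewrite -lactA pJ_lact. Qed.
Lemma pJ_actk (c : k) : pJ (lact (ink c) (dl_D L)) = ink c.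
Proof. by rewrite [LHS]pJZ pJ_D mulr1. Qed.

Fact uJ_lact1 w : uJ_lact 1 w = w.
Proof. by rewrite /uJ_lact pJ_act1 mul1r. Qed.
Fact uJ_lactA a b w : uJ_lact a (uJ_lact b w) = uJ_lact (a * b) w.
Proof. by rewrite /uJ_lact pJ_actM mulrA. Qed.
Fact uJ_lactDl a b w : uJ_lact (a + b) w = uJ_lact a w + uJ_lact b w.
Proof. by rewrite /uJ_lact pJ_actD mulrDl. Qed.
Fact uJ_lactDr a v w : uJ_lact a (v + w) = uJ_lact a v + uJ_lact a w.
Proof. exact: mulrDr. Qed.
Fact uJ_ract1 w : uJ_ract w 1 = w.
Proof. by rewrite /uJ_ract pJ_act1 mulr1. Qed.
Fact uJ_ractA a b w : uJ_ract (uJ_ract w a) b = uJ_ract w (a * b).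
Proof. by rewrite /uJ_ract pJ_actM mulrA. Qed.
Fact uJ_ractDl a v w : uJ_ract (v + w) a = uJ_ract v a + uJ_ract w a.
Proof. exact: mulrDl. Qed.
Fact uJ_ractDr a b w : uJ_ract w (a + b) = uJ_ract w a + uJ_ract w b.
Proof. by rewrite /uJ_ract pJ_actD mulrDr. Qed.
Fact uJ_lractC a b w : uJ_ract (uJ_lact a w) b = uJ_lact a (uJ_ract w b).
Proof. by rewrite /uJ_ract /uJ_lact mulrA. Qed.
Fact uJ_lractk (c : k) w : uJ_ract w (ink c) = uJ_lact (ink c) w.
Proof. by rewrite /uJ_ract /uJ_lact pJ_actk inkC. Qed.
Fact uJ_lact_ink (c : k) w : uJ_lact (ink c) w = ink c * w.
Proof. by rewrite /uJ_lact pJ_actk. Qed.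
Fact uJ_lactMl a v w : uJ_lact a (v * w) = uJ_lact a v * w.
Proof. by rewrite /uJ_lact mulrA. Qed.
Fact uJ_ractMr a v w : uJ_ract (v * w) a = v * uJ_ract w a.
Proof. by rewrite /uJ_ract mulrA. Qed.
HB.instance Definition _ := Zmodule_isBimod.Build k A uJ
  uJ_lact1 uJ_lactA uJ_lactDl uJ_lactDr uJ_ract1 uJ_ractA uJ_ractDl uJ_ractDr
  uJ_lractC uJ_lractk.

End Universal.

(* The objects of Alg(k, A (x)_k A). The (A (x)_k A)-module structure is
   required to be compatible with the product, as the one of U_J is: a acts on
   the left as multiplication by a1 and on the right as multiplication by 1a,
   and k acts through the structure map of R. Without this an algebra map out
   of U_J extending an (A (x)_k A)-linear map need not be linear itself. *)
HB.mixin Record isBimodAlg (k : comPzRingType) (A : comPzAlgType k) R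
    of PzAlgebra k R & Bimod k A R := {
  lact_ink : forall (c : k) (r : R), lact (ink c) r = ink c * r;
  lactMl : forall a (r s : R), lact a (r * s) = lact a r * s;
  ractMr : forall a (r s : R), ract (r * s) a = r * ract s a
}.
#[short(type="bimodAlgType")]
HB.structure Definition BimodAlg (k : comPzRingType) (A : comPzAlgType k) :=
  {R of PzAlgebra k R & Bimod k A R & isBimodAlg k A R}.

Section Category.
Variables (k : comPzRingType) (A : comPzAlgType k).

Record bahom (R S : bimodAlgType A) := Bahom {
  hom_fun :> R -> S;
  hom_alg : is_alg_hom hom_fun;
  hom_bimod : is_bimod_hom hom_fun
}.

Lemma hom_eq (R S : bimodAlgType A) (g h : bahom R S) :
  hom_fun g =1 hom_fun h -> g = h.
Proof.
case: g h => [g ga gb] [h ha hb] /= /funext gh.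
by case: _ / gh in ha hb *; congr Bahom; exact: Prop_irrelevance.
Qed.

Definition hom_id (R : bimodAlgType A) : bahom R R.
Proof. by exists id. Defined.

Definition hom_comp (R S T : bimodAlgType A) (h : bahom S T) (g : bahom R S) :
  bahom R T.
Proof.
exists (fun x => h (g x)).
- case: (hom_alg g) (hom_alg h) => gD gM g1 gk [hD hM h1 hk].
  by split=> *; rewrite ?(gD, gM, g1, gk, hD, hM, h1, hk).
- case: (hom_bimod g) (hom_bimod h) => gD gl gr [hD hl hr].
  by split=> *; rewrite ?(gD, gl, gr, hD, hl, hr).
Defined.

Definition is_iso (R S : bimodAlgType A) (h : bahom R S) : Prop :=
  exists g : bahom S R, hom_comp g h = hom_id R /\ hom_comp h g = hom_id S.

Record functor := Functor {
  F_obj :> bimodAlgType A -> Type;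
  F_map : forall R S : bimodAlgType A, bahom R S -> F_obj R -> F_obj S;
  F_id : forall R (x : F_obj R), F_map (hom_id R) x = x;
  F_comp : forall R S T (h : bahom S T) (g : bahom R S) (x : F_obj R),
    F_map (hom_comp h g) x = F_map h (F_map g x)
}.
Arguments F_map _ {R S} _ _.

Definition isomorphic_functors (F G : functor) : Prop :=
  exists eta : forall R, F R -> G R,
    (forall R, bijective (eta R)) /\
    (forall (R S : bimodAlgType A) (h : bahom R S) (x : F R),
       eta S (F_map F h x) = F_map G h (eta R x)).

Definition hom_functor (U : bimodAlgType A) : functor.
Proof.
exists (fun R => bahom U R) (fun R S h g => hom_comp h g).
- by move=> R x; exact: hom_eq.
- by move=> R S T h g x; exact: hom_eq.
Defined.

(* (U, u) represents F: the natural map Hom(U, R) -> F(R), phi |-> F(phi)(u), is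
   a bijection for every R. *)
Definition represents (F : functor) (U : bimodAlgType A) (u : F U) : Prop :=
  forall R : bimodAlgType A,
    bijective (fun phi : bahom U R => F_map F phi u).

End Category.

Arguments F_map {k A} _ {R S} _ _.

Section Conn.
Variables (k : comPzRingType) (A : comPzAlgType k) (f : cocycle2 A).
Variables (L : dLieAlg f) (J : ideal2 (uotimes L)).

HB.instance Definition _ := isBimodAlg.Build k A (uJ J)
  (@uJ_lact_ink k A f L J) (@uJ_lactMl k A f L J) (@uJ_ractMr k A f L J).

Record conn (R : bimodAlgType A) := Conn {
  conn_fun :> L -> R;
  conn_bimod : is_bimod_hom conn_fun;
  conn_D : conn_fun (dl_D L) = 1;
  conn_J : forall t, preJ J t -> tens_lift conn_fun t = 0
}.

Lemma conn_eq (R : bimodAlgType A) (r s : conn R) :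
  conn_fun r =1 conn_fun s -> r = s.
Proof.
case: r s => [r rb rD rJ] [s sb sD sJ] /= /funext rs.
by case: _ / rs in sb sD sJ *; congr Conn; exact: Prop_irrelevance.
Qed.

Lemma bimod_homZ (R : bimodAlgType A) (rho : L -> R) :
  is_bimod_hom rho -> forall (c : k) u, rho (kscale c u) = ink c * rho u.
Proof. by case=> _ rl _ c u; rewrite /kscale rl lact_ink. Qed.

Definition conn_map (R S : bimodAlgType A) (h : bahom R S) (rho : conn R) :
  conn S.
Proof.
exists (fun u => h (rho u)).
- case: (conn_bimod rho) (hom_bimod h) => rD rl rr [hD hl hr].
  by split=> *; rewrite ?(rD, rl, rr, hD, hl, hr).
- by rewrite conn_D; case: (hom_alg h).
- move=> t /(conn_J rho) rt0.
  have rb := conn_bimod rho; have rZ := bimod_homZ rb.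
  case: (rb) => rD _ _; have [[lD lM l1 lk] li] := tens_liftP rD rZ.
  case: (hom_alg h) => hD hM h1 hk.
  rewrite -(@tens_lift_uniq _ _ _ _ _ _ _ (fun t => h (tens_lift rho t))).
  + by rewrite rt0; apply: (addrI (h 0)); rewrite -hD !addr0.
  + by move=> *; rewrite rD hD.
  + by move=> *; rewrite rZ hM hk.
  + by split=> *; rewrite ?(lD, lM, l1, lk, hD, hM, h1, hk).
  + by move=> m; rewrite li.
Defined.

Definition conn_functor : functor A.
Proof.
exists conn conn_map.
- by move=> R x; exact: conn_eq.
- by move=> R S T h g x; exact: conn_eq.
Defined.

Definition pJ_conn : conn (uJ J).
Proof.
exists (pJ J).
- by split; [exact: pJD|exact: pJ_lact|exact: pJ_ract].
- exact: pJ_D.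
- move=> t Jt.
  rewrite -(tens_lift_uniq (@pJD _ _ _ _ J) (@pJZ _ _ _ _ J)
    (uJ_can_alg_hom J)) //.
  by apply: quot_pi_eq; rewrite subr0.
Defined.

End Conn.

(* Main.v *)
(* A connection rho extends to T(rho) on the tensor algebra, and T(rho) kills
   J_T by definition, so it descends to U_J; as U_J is generated by the image
   of p_J, the descended map is unique.  It is linear for both A-actions because
   a acts on U_J as left or right multiplication by p_J(aD), which is sent to
   rho(aD) = a1 = 1a, as aD = Da.  Uniqueness of the representing pair is then
   Yoneda. *)
Require Import Defs.
From HB Require Import structures.
From mathcomp Require Import all_boot all_algebra.

Set Implicit Arguments.
Unset Strict Implicit.
Unset Printing Implicit Defensive.

Import GRing.Theory.
Local Open Scope ring_scope.

Lemma alg_homB (k : comPzRingType) (R S : pzAlgType k) (h : R -> S) x y :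
  is_alg_hom h -> h (x - y) = h x - h y.
Proof.
by move=> hh; case: (hh) => hD _ _ _; apply/eqP; rewrite eq_sym subr_eq -hD subrK.
Qed.

Lemma alg_hom_comp (k : comPzRingType) (R S T : pzAlgType k)
    (g : S -> T) (h : R -> S) :
  is_alg_hom g -> is_alg_hom h -> is_alg_hom (g \o h).
Proof.
by move=> [gD gM g1 gk] [hD hM h1 hk]; split=> * /=;
  rewrite ?(hD, hM, h1, hk) ?(gD, gM, g1, gk).
Qed.

Lemma represents_unique (k : comPzRingType) (A : comPzAlgType k)
    (F : functor A) (U U' : bimodAlgType A) (u : F U) (u' : F U') :
  represents u -> represents u' ->
  exists! psi : bahom U U', is_iso psi /\ F_map F psi u = u'.
Proof.
move=> repu repu'; have [g _ gK] := repu U'; have [g' _ g'K] := repu' U.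
(* An endomorphism fixing a universal element has the same value there as the identity, and
   evaluation at that element is injective. *)
have injE (V : bimodAlgType A) (v : F V) (h : bahom V V) :
    represents v -> F_map F h v = v -> h = hom_id V.
  by move=> /(_ V)/bij_inj injv hv; apply: injv; rewrite hv F_id.
exists (g u'); split; last first.
  by move=> psi [_ psiu]; apply: (bij_inj (repu U')); rewrite psiu gK.
split; last exact: gK.
(* The inverse is the map carrying [u'] back to [u], so both composites fix a universal element. *)
by exists (g' u); split; apply: injE => //; rewrite F_comp ?gK ?g'K ?gK.
Qed.

Section Lift.
Variables (k : comPzRingType) (A : comPzAlgType k) (f : cocycle2 A).
Variables (L : dLieAlg f) (J : ideal2 (uotimes L)).

(** [uJ J] is a quotient of a quotient of the tensor algebra, so two [rep]s give a preimage of
    [w]. *)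
Lemma uJW (P : uJ J -> Prop) : (forall t, P (uJ_can J t)) -> forall w, P w.
Proof. by move=> Pcan w; rewrite -(repK w) -(repK (rep w)); exact: Pcan. Qed.

Lemma uJ_can_inj s t : uJ_can J s = uJ_can J t -> preJ J (s - t).
Proof.
move=> /quot_pi_inj; rewrite -(alg_homB _ _ (quot_pi_alg_hom _)); exact.
Qed.

(** Composed with [uJ_can J], both become algebra maps on the tensor algebra with equal values on
    generators, hence the same [tens_lift]. *)
Lemma bahom_uJ_eq (R : bimodAlgType A) (g h : bahom (uJ J) R) :
  (forall u, g (pJ J u) = h (pJ J u)) -> g = h.
Proof.
move=> gh; apply: hom_eq; elim/uJW=> t.
have comp_alg (e : bahom (uJ J) R) : is_alg_hom (e \o uJ_can J).
  exact: alg_hom_comp (hom_alg e) (uJ_can_alg_hom J).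
(* [h] after [pJ J] underlies a connection, which supplies the linearity that [tens_lift_uniq] asks
   for. *)
have rho_bimod := conn_bimod (conn_map h (pJ_conn J)).
have [rhoD _ _] := rho_bimod; have rhoZ := bimod_homZ rho_bimod.
transitivity (tens_lift (fun u => h (pJ J u)) t).
  by apply (tens_lift_uniq rhoD rhoZ (comp_alg g) gh).
by symmetry; apply (tens_lift_uniq rhoD rhoZ (comp_alg h)).
Qed.

Section ConnLift.
Variables (R : bimodAlgType A) (rho : conn J R).

Let rhoD m n : rho (m + n) = rho m + rho n.
Proof. by case: (conn_bimod rho). Qed.

Let rhoZ := bimod_homZ (conn_bimod rho).

Definition conn_lift_fun (w : uJ J) : R := tens_lift rho (rep (rep w)).

(** The chosen representative and [t] have the same class, so they differ by an element of J_T,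
    which T(rho) kills. *)
Lemma conn_lift_can t : conn_lift_fun (uJ_can J t) = tens_lift rho t.
Proof.
have [lift_alg _] := tens_liftP rhoD rhoZ.
apply/eqP; rewrite -subr_eq0 -(alg_homB _ _ lift_alg); apply/eqP.
by apply: (conn_J rho); apply: uJ_can_inj; rewrite /uJ_can /quot_pi !repK.
Qed.

Lemma conn_lift_pJ u : conn_lift_fun (pJ J u) = rho u.
Proof. by rewrite conn_lift_can; have [_ ->] := tens_liftP rhoD rhoZ. Qed.

Lemma conn_lift_alg : is_alg_hom conn_lift_fun.
Proof.
have [[lD lM l1 lk] _] := tens_liftP rhoD rhoZ.
have [canD canM can1 cank] := uJ_can_alg_hom J.
split.
- by elim/uJW=> s; elim/uJW=> t; rewrite -canD !conn_lift_can lD.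
- by elim/uJW=> s; elim/uJW=> t; rewrite -canM !conn_lift_can lM.
- by rewrite -can1 conn_lift_can.
- by move=> c; rewrite -cank conn_lift_can.
Qed.

Lemma conn_lift_bimod : is_bimod_hom conn_lift_fun.
Proof.
have [hD hM _ _] := conn_lift_alg; have [_ rl _] := conn_bimod rho.
split=> // [a w | w a].
- by rewrite hM conn_lift_pJ rl conn_D -lactMl mul1r.
- (* on D the two actions of L agree, since pi(D) = 0 *)
  have DE : lact a (dl_D L) = ract (dl_D L) a.
    rewrite dl_ract dl_pi_D; have -> : (0 : der A) a = 0 by [].
    (* The leftover term [lact 0 (dl_D L)] equals its own double, hence is zero. *)
    by rewrite -[LHS]addr0; congr (_ + _); apply: (addrI (lact 0 (dl_D L)));
      rewrite -lactDl !addr0.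
  have [_ _ rr] := conn_bimod rho.
  (* The right action on [uJ J] multiplies by the image of the left multiple aD, whereas [ractMr]
     needs 1a; [DE] bridges the two. *)
  by rewrite hM conn_lift_pJ DE rr conn_D -ractMr mulr1.
Qed.

Definition conn_lift : bahom (uJ J) R := Bahom conn_lift_alg conn_lift_bimod.

End ConnLift.

Lemma conn_liftK (R : bimodAlgType A) (rho : conn J R) :
  conn_map (conn_lift rho) (pJ_conn J) = rho.
Proof. by apply: conn_eq => u; exact: conn_lift_pJ. Qed.

Lemma conn_mapK (R : bimodAlgType A) (h : bahom (uJ J) R) :
  conn_lift (conn_map h (pJ_conn J)) = h.
Proof. by apply: bahom_uJ_eq => u; exact: conn_lift_pJ. Qed.

Lemma conn_lift_natural (R S : bimodAlgType A) (h : bahom R S)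
    (rho : conn J R) :
  conn_lift (conn_map h rho) = hom_comp h (conn_lift rho).
Proof. by apply: bahom_uJ_eq => u; rewrite /= !conn_lift_pJ. Qed.

End Lift.

Theorem proposition3p12 (k : comPzRingType) (A : comPzAlgType k)
    (f : cocycle2 A) (L : dLieAlg f) (J : ideal2 (uotimes L)) :
  [/\ isomorphic_functors (conn_functor J) (hom_functor (uJ J)),
      represents (F := conn_functor J) (U := uJ J) (pJ_conn J) &
      forall (U' : bimodAlgType A) (p' : conn_functor J U'),
        represents (F := conn_functor J) p' ->
        exists! psi : bahom (uJ J) U',
          is_iso psi /\ F_map (conn_functor J) psi (pJ_conn J) = p'].
Proof.
have repJ : represents (F := conn_functor J) (U := uJ J) (pJ_conn J).
  move=> R; exists (@conn_lift _ _ _ _ J R); [exact: conn_mapK|].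
  exact: conn_liftK.
split=> // [|U' p' repp']; last exact: represents_unique.
(* The natural isomorphism is lifting; its inverse at each [R] pushes [pJ_conn J] forward along
   [h]. *)
exists (fun R => @conn_lift _ _ _ _ J R); split=> [R|R S h rho].
  exists (fun h : bahom (uJ J) R => conn_map h (pJ_conn J)).
    exact: conn_liftK.
  exact: conn_mapK.
exact: conn_lift_natural.
Qed.
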